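(* Let $I$ be an AI instance with decomposition $I=O'\cup\bigcup_{k=1}^h\{a_k,b_k,c_k\}$ as in the context, and let $I'=I\setminus O'=\bigcup_{k=1}^h\{a_k,b_k,c_k\}$. Suppose $I'\neq\emptyset$. For an item $a\in I'$ let $F(a)$ be the set of multisets $\{x,y\}$ of integers for which there exist distinct items $b,c\in I'\setminus\{a\}$ with $w_b=x$, $w_c=y$ and $w_a+x+y=W$. Then: (i) there exists an item $a\in I'$ with $|F(a)|=1$; (ii) for any item $a\in I'$ with $|F(a)|=1$, say $F(a)=\{\{x,y\}\}$, there exists $k\in\{1,\dots,h\}$ such that $\{w_a,x,y\}=\{w_{a_k},w_{b_k},w_{c_k}\}$ as multisets.
   Context: A Bin Packing Problem (BPP) instance consists of a finite set of items, each item $i$ with a positive integer weight $w_i$, and a positive integer bin capacity $W$. For an instance $J$, $z_{\mathrm{ILP}}^J$ denotes the minimum number of bins of capacity $W$ into which $J$ can be partitioned, and $z_{\mathrm{LP}}^J$ the optimal value of the linear relaxation of the set covering formulation $\min\sum_P x_P$ s.t. $\sum_P a_{iP}x_P\ge1$ for every item $i$, $x\ge0$, over all multisets $P$ of items of total weight at most $W$ ($a_{iP}$ the multiplicity of $i$ in $P$). An ANI instance is a BPP instance $I_0$ with capacity $W$ whose items are partitioned as $I_0=O\cup\bigcup_{k=1}^h\{a_k,b_k,c_k\}$ ($h\ge0$) with $|O|=15$, $\sum_{i\in O}w_i=3W$, $z_{\mathrm{LP}}^O=3$, $z_{\mathrm{ILP}}^O=4$, $w_{a_k}+w_{b_k}+w_{c_k}=W$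 for each $k$, and for each $k$ no subset $S\subseteq O\cup\{a_g,b_g,c_g:1\le g\le k-1\}$ satisfies $\sum_{i\in S}w_i+w_{a_k}=W$. An AI instance $I$ is obtained from such an ANI instance by choosing $o\in O$ and replacing it by two items $o_1,o_2$ with positive integer weights summing to $w_o$, such that $O'=(O\setminus\{o\})\cup\{o_1,o_2\}$ satisfies $z_{\mathrm{LP}}^{O'}=z_{\mathrm{ILP}}^{O'}=3$; thus $I=O'\cup\bigcup_{k=1}^h\{a_k,b_k,c_k\}$. *)

(* Defs.v *)
From mathcomp Require Import all_boot all_order all_algebra.
From mathcomp Require Import finmap multiset.
From mathcomp Require Import reals.

Set Implicit Arguments.
Unset Strict Implicit.
Unset Printing Implicit Defensive.

Import Order.TTheory GRing.Theory Num.Theory.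

Local Open Scope nat_scope.

(* Items live in an ambient finite type T carrying the weights, so that
   instances obtained from one another by exchanging items are all finite
   sets J : {set T} sharing the same w and W. *)

Definition bpp_instance (T : finType) (w : T -> nat) (W : nat) (J : {set T}) :=
  0 < W /\ forall i, i \in J -> 0 < w i.

Section BinPacking.
Variables (T : finType) (w : T -> nat) (W : nat).
Implicit Types J : {set T}.

Definition bin_packing J (B : {set {set T}}) :=
  partition B J /\ forall S, S \in B -> \sum_(i in S) w i <= W.

Definition zILP_is J (n : nat) :=
  (exists2 B, bin_packing J B & #|B| = n) /\
  (forall B, bin_packing J B -> n <= #|B|).

Definition pattern J (P : {mset T}%mset) :=
  (forall i, i \in P -> i \in J) /\ \sum_(i : T) P i * w i <= W.

(* With positive weights there are only finitely many patterns, so every vector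
   indexed by the patterns is a finitely supported function on multisets that
   vanishes outside the patterns. *)
Definition cover_feasible (R : realType) J
    (x : {fsfun {mset T}%mset -> R with 0%R}) :=
  [/\ forall P, P \in finsupp x -> pattern J P,
      forall P, (0 <= x P)%R
    & forall i, i \in J -> (1 <= \sum_(P <- finsupp x) (P i)%:R * x P)%R].

Definition cover_value (R : realType)
    (x : {fsfun {mset T}%mset -> R with 0%R}) : R :=
  (\sum_(P <- finsupp x) x P)%R.

Definition zLP_is (R : realType) J (v : R) :=
  (exists2 x, cover_feasible J x & cover_value x = v) /\
  (forall x, cover_feasible J x -> (v <= cover_value x)%R).

End BinPacking.

Section Instances.
Variables (R : realType) (T : finType) (w : T -> nat) (W : nat).
Variables (h : nat) (a b c : 'I_h -> T).

Definition triple (k : 'I_h) : {set T} := [set a k; b k; c k].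

Record is_ANI (I0 O : {set T}) : Prop := {
  ANI_bpp : bpp_instance w W I0;
  ANI_items : I0 = O :|: \bigcup_k triple k;
  ANI_triple_uniq : forall k, uniq [:: a k; b k; c k];
  ANI_O_disjoint : forall k, [disjoint O & triple k];
  ANI_triple_disjoint : forall k g : 'I_h, k != g -> [disjoint triple k & triple g];
  ANI_O_card : #|O| = 15;
  ANI_O_weight : \sum_(i in O) w i = 3 * W;
  ANI_O_zLP : zLP_is w W O (3%:R : R)%R;
  ANI_O_zILP : zILP_is w W O 4;
  ANI_triple_weight : forall k, w (a k) + w (b k) + w (c k) = W;
  ANI_no_fill : forall (k : 'I_h) (S : {set T}),
    S \subset O :|: \bigcup_(g < h | g < k) triple g ->
    \sum_(i in S) w i + w (a k) <> W
}.

Record is_AI_from (I0 O : {set T}) (o o1 o2 : T) (I O' : {set T}) : Prop := {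
  AI_ANI : is_ANI I0 O;
  AI_o : o \in O;
  AI_o1_fresh : o1 \notin I0;
  AI_o2_fresh : o2 \notin I0;
  AI_o12 : o1 != o2;
  AI_o1_gt0 : 0 < w o1;
  AI_o2_gt0 : 0 < w o2;
  AI_split : w o1 + w o2 = w o;
  AI_O' : O' = (O :\ o) :|: [set o1; o2];
  AI_O'_zLP : zLP_is w W O' (3%:R : R)%R;
  AI_O'_zILP : zILP_is w W O' 3;
  AI_items : I = O' :|: \bigcup_k triple k
}.

Definition is_AI (I O' : {set T}) :=
  exists I0 O o o1 o2, is_AI_from I0 O o o1 o2 I O'.

End Instances.

Definition completions (T : finType) (w : T -> nat) (W : nat) (I' : {set T})
    (e : T) : {set T * T} :=
  [set p : T * T | [&& p.1 \in I' :\ e, p.2 \in I' :\ e, p.1 != p.2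
                     & w e + w p.1 + w p.2 == W]].

(* Weights are natural numbers, so the integers x, y in the members of F(e) are
   natural numbers as well. *)
Definition F (T : finType) (w : T -> nat) (W : nat) (I' : {set T}) (e : T) :
    {fset {mset nat}%mset}%fset :=
  [fset [mset w p.1; w p.2]%mset | p in completions w W I' e]%fset.

(* Main.v *)
Require Import Defs.
From mathcomp Require Import all_boot all_order all_algebra.
From mathcomp Require Import finmap multiset.
From mathcomp Require Import reals.
From mathcomp Require Import zify.

Set Implicit Arguments.
Unset Strict Implicit.
Unset Printing Implicit Defensive.

Local Open Scope nat_scope.

(** A set filling the bin together with [a k] cannot live in [O] and the
    earlier triples. For the last triple, a pair completing [a k] inside [I']
    must therefore contain [b k] or [c k], and the other weight is then forced,
    so [F (a k)] is a singleton. Conversely every item of [I'] is completed by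
    the rest of its own triple, which is thus the only element of a singleton
    [F e]. *)

Lemma mset2C (K : choiceType) (x y : K) : ([mset x; y] = [mset y; x])%mset.
Proof. by apply/msetP => z; rewrite !msetE2 !msetnE addnC. Qed.

Lemma mset3_rotate (K : choiceType) (x y z : K) :
  ([mset x; y; z] = [mset y; z; x])%mset.
Proof. by apply/msetP => t; rewrite !msetE2 !msetnE; lia. Qed.

(** Isolates the last two elements as a sub-multiset, so that an equality of pairs can be rewritten
    inside a triple. *)
Lemma mset3_consE (K : choiceType) (x y z : K) :
  ([mset x; y; z] = x +` [mset y; z])%mset.
Proof. by apply/msetP => t; rewrite !msetE2 !msetnE; lia. Qed.

Section Completions.
Variables (T : finType) (w : T -> nat) (W : nat) (J : {set T}).

Lemma mem_F (e u v : T) : u \in J -> v \in J -> uniq [:: e; u; v] ->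
  w e + w u + w v = W -> ([mset w u; w v]%mset \in F w W J e).
Proof.
move=> uJ vJ; rewrite /= !inE negb_or -!andbA => /and4P[eu ev uv _] ws.
apply/imfsetP; exists (u, v) => //=.
by rewrite !inE /= uJ vJ uv ws eqxx eq_sym eu eq_sym ev.
Qed.

(** One common item is enough: if a completing pair contains [u] or [v], the total [W] forces its
    other weight, so the two pairs of weights agree. *)
Lemma F_singleton (e u v : T) : u \in J -> v \in J -> uniq [:: e; u; v] ->
  w e + w u + w v = W ->
  (forall p q, p \in J :\ e -> q \in J :\ e -> p != q -> w e + w p + w q = W ->
     (p \in [set u; v]) || (q \in [set u; v])) ->
  F w W J e = [fset [mset w u; w v]%mset]%fset.
Proof.
move=> uJ vJ euv ws only; apply/fsetP => M; rewrite in_fset1.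
apply/idP/eqP => [|->]; last exact: mem_F.
case/imfsetP => -[p q] /=; rewrite inE /= => /and4P[pJ qJ pq /eqP pqW] ->.
have uv_of (x y : T) : w e + w x + w y = W -> x \in [set u; v] ->
    [mset w x; w y]%mset = [mset w u; w v]%mset.
  move=> xyW; rewrite !inE => /orP[]/eqP ex; subst x.
    by have -> : w y = w v by lia.
  by have -> : w y = w u by [lia]; rewrite mset2C.
case/orP: (only _ _ pJ qJ pq pqW); first exact: uv_of.
by rewrite mset2C; apply: uv_of; lia.
Qed.

End Completions.

Section TripleItems.
Variables (R : realType) (T : finType) (w : T -> nat) (W : nat).
Variables (h : nat) (a b c : 'I_h -> T).

(** The triples are disjoint from [O], and the new items [o1], [o2] lie outside [I0], hence outside
    every triple. *)
Lemma AI_setD (I O' : {set T}) :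
  is_AI R w W a b c I O' -> I :\: O' = \bigcup_k triple a b c k.
Proof.
case=> I0 [O [o [o1 [o2 [ANI _ o1I o2I _ _ _ _ defO' _ _ defI]]]]].
rewrite defI setDUl setDv set0U; apply/setDidPl; rewrite disjoint_subset.
apply/subsetP => i iU; rewrite inE defO' !inE.
have iI0 : i \in I0 by rewrite (ANI_items ANI) inE iU orbT.
have iO : i \notin O.
  case/bigcupP: iU => k _ ik.
  by have /disjointFl -> := ANI_O_disjoint ANI k.
rewrite (negbTE iO) andbF /= negb_or.
by apply/andP; split; apply: contraTneq iI0 => ->.
Qed.

Variables (I0 O : {set T}).
Hypothesis ANI : is_ANI R w W a b c I0 O.
Let J := \bigcup_k triple a b c k.

Lemma mem_triples k i : i \in triple a b c k -> i \in J.
Proof. by move=> ik; apply/bigcupP; exists k. Qed.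

Lemma F_last_triple (k : 'I_h) : (forall g : 'I_h, g <= k) ->
  F w W J (a k) = [fset [mset w (b k); w (c k)]%mset]%fset.
Proof.
move=> last_k; apply: F_singleton.
- by apply: (@mem_triples k); rewrite !inE eqxx orbT.
- by apply: (@mem_triples k); rewrite !inE eqxx orbT.
- exact: ANI_triple_uniq ANI k.
- exact: ANI_triple_weight ANI k.
move=> p q pJ qJ pq pqW; apply/negPn/negP; rewrite negb_or => /andP[pbc qbc].
(* An item outside triple [k] has an index different from [k], hence smaller by maximality of
   [k]. *)
have earlier i : i \in J :\ a k -> i \notin [set b k; c k] ->
    i \in \bigcup_(g < h | g < k) triple a b c g.
  rewrite !inE => /andP[ia /bigcupP[g _ ig]] ibc.
  apply/bigcupP; exists g => //; rewrite ltn_neqAle last_k andbT.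
  apply: contraNneq ibc => gk; move: ig.
  by rewrite (ord_inj gk) !inE (negbTE ia).
apply: (ANI_no_fill ANI (k := k) (S := [set p; q])).
  by rewrite subUset !sub1set !inE !earlier ?orbT.
by rewrite big_setU1 ?inE //= big_set1; lia.
Qed.

(** The witnesses are the other two items of the triple, taken in cyclic order after [e], so that
    both claims reduce to rotations. *)
Lemma mem_F_triple k e : e \in triple a b c k -> exists u v,
  ([mset w u; w v]%mset \in F w W J e) /\
  ([mset w e; w u; w v] = [mset w (a k); w (b k); w (c k)])%mset.
Proof.
have abc := ANI_triple_uniq ANI k; have abcW := ANI_triple_weight ANI k.
have aJ : a k \in J by apply: (@mem_triples k); rewrite !inE eqxx.
have bJ : b k \in J by apply: (@mem_triples k); rewrite !inE eqxx orbT.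
have cJ : c k \in J by apply: (@mem_triples k); rewrite !inE eqxx orbT.
rewrite !inE -orbA => /or3P[]/eqP->.
- by exists (b k), (c k); split; first exact: mem_F.
- exists (c k), (a k); split; last by rewrite -mset3_rotate.
  by apply: mem_F => //; [rewrite -(rot_uniq 2) | lia].
- exists (a k), (b k); split; last exact: mset3_rotate.
  by apply: mem_F => //; [rewrite -(rot_uniq 1) | lia].
Qed.

End TripleItems.

Theorem theorem1 (R : realType) (T : finType) (w : T -> nat) (W : nat)
    (h : nat) (a b c : 'I_h -> T) (I O' : {set T}) :
  is_AI R w W a b c I O' ->
  I :\: O' <> set0 ->
  (exists2 e, e \in I :\: O' & #|` F w W (I :\: O') e|%fset = 1) /\
  (forall e, e \in I :\: O' -> #|` F w W (I :\: O') e|%fset = 1 ->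
    forall x y : nat, F w W (I :\: O') e = [fset [mset x; y]%mset]%fset ->
    exists k : 'I_h,
      ([mset w e; x; y] = [mset w (a k); w (b k); w (c k)])%mset).
Proof.
move=> AI; rewrite (AI_setD AI).
case: AI => I0 [O [_ [_ [_ [ANI _ _ _ _ _ _ _ _ _ _ _]]]]] /eqP/set0Pn[i].
case/bigcupP => k0 _ _; split=> [|e /bigcupP[k _ ek] _ x y FE].
  (* The index [k0] only shows that some triple exists; the last one provides the item for (i). *)
  case: (@arg_maxnP _ k0 xpredT (fun g : 'I_h => g : nat)) => // k _ last_k.
  exists (a k); first by apply: (@mem_triples _ _ _ _ _ k); rewrite !inE eqxx.
  by rewrite (F_last_triple ANI) ?cardfs1 // => g; apply: last_k.
exists k; have [u [v [uvF <-]]] := mem_F_triple ANI ek.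
(* The rest of the triple of [e] gives an element of [F e], which must be the unique one. *)
move: uvF; rewrite FE in_fset1 => /eqP uvE.
by rewrite !mset3_consE uvE.
Qed.
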